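(* Let $\mathcal{F}$ be the set of finite subsets of $\mathbb{Q}_{>0}$, and let $\rho:\mathbb{Q}_{<0}\to\mathcal{F}$ be a map such that for every $F\in\mathcal{F}$ the fiber $\rho^{-1}(F)$ is dense and codense in $\mathbb{Q}_{<0}$. Let $A\subseteq\mathbb{Q}^2$ be the binary relation defined by $A(x,y)\iff x<0<y$ and $y\in\rho(x)$. Then the open core of the structure $(\mathbb{Q},<,0,A)$ is o-minimal.
   Context: ''Definable'' always means definable with parameters. For a structure $\mathcal{R}=(R,<,\ldots)$ expanding a dense linear order without endpoints, give $R$ the order topology and $R^n$ the product topology. The open core $\mathcal{R}^{\circ}$ of $\mathcal{R}$ is the structure with universe $R$ whose language consists of a relation symbol for each open set $U\subseteq R^n$, for every $n$, that is definable (with parameters) in $\mathcal{R}$. A structure is o-minimal if every subset of its universe definable with parameters is a finite union of points and intervals (with endpoints in the universe or $\pm\infty$). A set $D\subseteq\mathbb{Q}_{<0}$ is codense in $\mathbb{Q}_{<0}$ if $\mathbb{Q}_{<0}\setminus D$ is dense in $\mathbb{Q}_{<0}$. *)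

(* Defs.v *)
From mathcomp Require Import all_boot all_order all_algebra.
From mathcomp Require Import finmap.
From mathcomp Require Import all_classical.
From mathcomp Require Import topology_structure order_topology.
From mathcomp Require Import function_spaces subtype_topology.

Set Implicit Arguments.
Unset Strict Implicit.
Unset Printing Implicit Defensive.

Import Order.TTheory GRing.Theory Num.Theory.

Local Open Scope classical_set_scope.

Record language := Language {
  funsym : Type;
  fun_arity : funsym -> nat;
  relsym : Type;
  rel_arity : relsym -> nat
}.

Section Syntax.
Variable L : language.

Inductive term :=
| TVar of nat
| TApp (f : funsym L) of ('I_(fun_arity f) -> term).

Inductive formula :=
| FEq of term & term
| FRel (r : relsym L) of ('I_(rel_arity r) -> term)
| FNot of formula
| FAnd of formula & formula
| FEx of nat & formula.

End Syntax.

Record structure (L : language) (T : Type) := Structure {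
  fun_interp : forall f : funsym L, ('I_(fun_arity f) -> T) -> T;
  rel_interp : forall r : relsym L, set ('I_(rel_arity r) -> T)
}.

Section Semantics.
Variables (L : language) (T : Type) (M : structure L T).

Fixpoint eval (v : nat -> T) (t : term L) : T :=
  match t with
  | TVar i => v i
  | TApp f ts => fun_interp M (fun k => eval v (ts k))
  end.

Fixpoint sat (v : nat -> T) (phi : formula L) : Prop :=
  match phi with
  | FEq s t => eval v s = eval v t
  | FRel r ts => rel_interp M (fun k => eval v (ts k))
  | FNot psi => ~ sat v psi
  | FAnd psi chi => sat v psi /\ sat v chi
  | FEx i psi => exists a : T, sat [eta v with i |-> a] psi
  end.

Definition extend n (x : 'I_n -> T) (v : nat -> T) : nat -> T :=
  fun k => if insub k is Some i then x i else v k.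

(* The variables of index >= n stand for the parameters: since a formula only
   contains finitely many variables, only finitely many values of [v] matter. *)
Definition definable n (X : set ('I_n -> T)) : Prop :=
  exists (phi : formula L) (v : nat -> T),
    X = [set x | sat (extend x v) phi].

End Semantics.

Section OpenCore.
Context {d : Order.disp_t} {T : orderType d}.

Definition open_in_power n (U : set ('I_n -> T)) : Prop :=
  open (U : set (prod_topology (fun _ : 'I_n => order_topology T))).

Definition o_minimal (L : language) (M : structure L T) : Prop :=
  forall X : set T,
    definable M [set x : 'I_1 -> T | X (x ord0)] ->
    exists (points : seq T) (intervals : seq (interval T)),
      X = [set` points] `|` \bigcup_(i in [set` intervals]) [set` i].

Variables (L : language) (M : structure L T).

Record definable_open := DefinableOpen {
  do_dim : nat;
  do_set : set ('I_do_dim -> T);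
  do_open : open_in_power do_set;
  do_definable : definable M do_set
}.

Definition open_core_language : language :=
  {| funsym := void;
     fun_arity := fun f => match f with end;
     relsym := definable_open;
     rel_arity := do_dim |}.

Definition open_core : structure open_core_language T :=
  {| fun_interp := fun f : funsym open_core_language => match f with end;
     rel_interp := fun r : relsym open_core_language => @do_set r |}.

End OpenCore.

Definition codense (T : topologicalType) (S : set T) : Prop := dense (~` S).

(* The coercion from sets to types gives these the subspace topology. *)
Definition Qneg : set (order_topology rat) := [set x : rat | (x < 0)%R].
Definition Qpos : set (order_topology rat) := [set y : rat | (0 < y)%R].

Definition A_rel (rho : Qneg -> {fset Qpos}) (x y : rat) : Prop :=
  exists (u : Qneg) (w : Qpos), [/\ x = \val u, y = \val w & w \in rho u].

Variant QA_relsym := LtSym | ASym.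

Definition QA_language : language :=
  {| funsym := unit;
     fun_arity := fun=> 0%N;
     relsym := QA_relsym;
     rel_arity := fun=> 2%N |}.

Definition QA_structure (rho : Qneg -> {fset Qpos}) :
    structure QA_language rat :=
  {| fun_interp := fun (_ : funsym QA_language) _ => 0%R;
     rel_interp := fun r : relsym QA_language =>
       match r return set ('I_2 -> rat) with
       | LtSym => [set x | (x 0 < x 1)%R]
       | ASym => [set x | A_rel rho (x 0%R) (x 1%R)]
       end |}.

(* Main.v *)
(* Let U be open and definable with parameters v, and let P consist of 0, the
   v_k and the elements of the sets rho(v_k).  Then U is invariant under every
   order automorphism g of Q fixing P pointwise, even though g ignores A: given x
   in U, openness and the density of the fibres allow replacing each negative
   coordinate x_i outside P by a nearby point t with rho(t) = g^-1(rho(g x_i)),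
   keeping the order type and staying in U.  The perturbed tuple and g x then
   have matching colours along g, so a back-and-forth argument shows that they
   satisfy the same formulas over v; hence g x is in U.

   Consequently every set definable in the open core is invariant under the order
   automorphisms of Q fixing some finite set P.  These act transitively on each
   cell of the complement of P, so a unary such set is a union of points of P and
   of cells. *)

Require Import Defs.
From mathcomp Require Import all_boot all_order all_algebra.
From mathcomp Require Import finmap.
From mathcomp Require Import all_classical.
From mathcomp Require Import topology_structure order_topology.
From mathcomp Require Import function_spaces subtype_topology.
From mathcomp Require Import supremum_topology.
From mathcomp Require Import lra.

Set Implicit Arguments.
Unset Strict Implicit.
Unset Printing Implicit Defensive.

Import Order.TTheory GRing.Theory Num.Theory.

Local Open Scope classical_set_scope.

(** * Order automorphisms of the rationals, built from affine pieces *)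

Definition order_auto (g : rat -> rat) : Prop :=
  {mono g : x y / (x < y)%R} /\ bijective g.

Lemma order_auto_inv (g h : rat -> rat) :
  order_auto g -> cancel g h -> cancel h g -> order_auto h.
Proof.
move=> [gm _] gK hK; split; last by exists g.
by move=> x y; rewrite -gm !hK.
Qed.

Definition glue (c : rat) (f g : rat -> rat) (t : rat) : rat :=
  if (t <= c)%R then f t else g t.

Lemma order_auto_glue (c : rat) (f g : rat -> rat) :
  order_auto f -> order_auto g -> f c = g c -> order_auto (glue c f g).
Proof.
move=> [fm [f' fK f'K]] [gm [g' gK g'K]] fgc.
split.
  apply/leW_mono/le_mono => s t st; rewrite /glue.
  case: (leP s c) => sc; case: (leP t c) => tc; rewrite ?fm ?gm //.
    by apply: (@le_lt_trans _ _ (f c)); rewrite ?fgc ?gm // leNgt -fgc fm -leNgt.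
  by move: (lt_trans st (le_lt_trans tc sc)); rewrite ltxx.
(* The inverse glues the two inverses at the common value [f c = g c]. *)
exists (glue (f c) f' g') => t; rewrite /glue.
  case: (leP t c) => tc; first by rewrite leNgt fm -leNgt tc fK.
  by rewrite fgc leNgt gm tc gK.
case: (leP t (f c)) => tc; first by rewrite f'K leNgt -fm f'K -leNgt tc.
by rewrite g'K leNgt -gm g'K -fgc tc.
Qed.

Lemma order_auto_id : order_auto id.
Proof. by split => //; exists id. Qed.

Lemma order_auto_affine (c k : rat) :
  (0 < k)%R -> order_auto (fun t => c + (t - c) * k)%R.
Proof.
move=> k0; split; first by move=> s t; rewrite ltrD2l ltr_pM2r // ltrD2r.
exists (fun t => c + (t - c) / k)%R => t.
  by rewrite [X in (X / k)%R]addrC addKr mulfK ?subrKC ?gt_eqF.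
by rewrite [X in (X * k)%R]addrC addKr divfK ?subrKC ?gt_eqF.
Qed.

(** The graph of [g] is the diagonal with its part over []a, b[] replaced by the two segments from
    [(a, a)] to [(x, y)] and from [(x, y)] to [(b, b)]. *)
Lemma order_auto_bump (a b x y : rat) : (a < x < b)%R -> (a < y < b)%R ->
  exists g, [/\ order_auto g, g x = y & forall t, ~~ (a < t < b)%R -> g t = t].
Proof.
move=> /andP[ax xb] /andP[ay yb].
pose f t : rat := (a + (t - a) * ((y - a) / (x - a)))%R.
pose h t : rat := (b + (t - b) * ((y - b) / (x - b)))%R.
have fx : f x = y by rewrite /f mulrC divfK ?subrKC //; lra.
have hx : h x = y by rewrite /h mulrC divfK ?subrKC //; lra.
have fa : f a = a by rewrite /f subrr mul0r addr0.
have hb : h b = b by rewrite /h subrr mul0r addr0.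
exists (glue a id (glue x f (glue b h id))); split.
- apply: order_auto_glue; first exact: order_auto_id; last first.
    by rewrite /glue (ltW ax).
  apply: order_auto_glue; last by rewrite /glue (ltW xb) fx.
    by apply: order_auto_affine; apply: divr_gt0; lra.
  apply: order_auto_glue => //; last exact: order_auto_id.
  by apply: order_auto_affine; rewrite -divrNN; apply: divr_gt0; lra.
- by rewrite /glue leNgt ax lexx fx.
- move=> t; rewrite negb_and -!leNgt /glue; case: leP => //= ta.
  rewrite le_eqVlt => /predU1P[<-|bt]; first by rewrite leNgt xb lexx hb.
  by rewrite !leNgt bt (lt_trans xb bt).
Qed.

(** * Cuts and cells of finite sets of rationals *)

Lemma finite_gap (x : rat) (R : seq rat) : {in R, forall r, (x < r)%R} ->
  exists2 m, (x < m)%R & {in R, forall r, (m < r)%R}.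
Proof.
elim: R => [_|r R IH xR]; first by exists (x + 1)%R => //; lra.
have [|m xm mR] := IH; first by move=> s sR; apply: xR; rewrite inE sR orbT.
have xr : (x < r)%R by apply: xR; rewrite inE eqxx.
exists (Num.min m ((x + r) / 2))%R; first by rewrite lt_min xm; lra.
move=> s; rewrite inE gt_min => /predU1P[->|/mR ->//].
by apply/orP; right; lra.
Qed.

Lemma finite_cut (L R : seq rat) : {in L & R, forall l r, (l < r)%R} ->
  exists m, {in L, forall l, (l < m)%R} /\ {in R, forall r, (m < r)%R}.
Proof.
(* A weak bound over [L] suffices: [finite_gap] pushes it strictly above [L] while staying below
   [R]. *)
move=> LR; suff [x Lx xR] : exists2 x, {in L, forall l, (l <= x)%R} &
    {in R, forall r, (x < r)%R}.
  have [m xm mR] := finite_gap xR; exists m; split => // l /Lx lx.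
  exact: le_lt_trans xm.
elim: L LR => [_|l L IH LR].
  elim: R => [|r R [x _ xR]]; first by exists 0%R.
  exists (Num.min x (r - 1))%R => // s; rewrite inE gt_min.
  by move=> /predU1P[->|/xR ->//]; apply/orP; right; lra.
have [|x Lx xR] := IH.
  by move=> a b aL bR; apply: LR => //; rewrite inE aL orbT.
exists (Num.max l x).
  by move=> s; rewrite inE le_max => /predU1P[->|/Lx ->]; rewrite ?lexx ?orbT.
by move=> r rR; rewrite gt_max xR // LR // inE eqxx.
Qed.

Lemma finite_cut_itv (L R : seq rat) : {in L & R, forall l r, (l < r)%R} ->
  exists a b, [/\ (a < b)%R, {in L, forall l, (l < a)%R} &
                {in R, forall r, (b < r)%R}].
Proof.
move=> /finite_cut[a [La aR]]; have [b ab bR] := finite_gap aR.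
by exists a, b; split.
Qed.

(** The hypothesis puts [x] and [y] in the same cell of the complement of [P], so some interval
    contains both and misses [P]; a bump supported there carries [x] to [y]. *)
Lemma order_auto_move (P : seq rat) (x y : rat) :
  {in P, forall p, (p < x) = (p < y) /\ (x < p) = (y < p)}%R ->
  x \notin P ->
  exists g, [/\ order_auto g, {in P, g =1 id} & g x = y].
Proof.
move=> Pxy xP.
have [|a [La aR]] := @finite_cut [seq p <- P | (p < x)%R] [:: x; y].
  move=> p z; rewrite mem_filter => /andP[px pP]; rewrite !inE.
  by move=> /orP[] /eqP-> //; rewrite -(Pxy p pP).1.
have [|b [Lb bR]] := @finite_cut [:: x; y] [seq p <- P | (x < p)%R].
  move=> z p + /[!mem_filter] /andP[px pP]; rewrite !inE.
  by move=> /orP[] /eqP-> //; rewrite -(Pxy p pP).2.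
have xi : (a < x < b)%R by rewrite aR ?Lb // !inE eqxx.
have yi : (a < y < b)%R by rewrite aR ?Lb // !inE eqxx orbT.
have [g [ga gx gfix]] := order_auto_bump xi yi.
exists g; split => // p pP; apply: gfix; rewrite negb_and -!leNgt.
case: (ltgtP p x) xP => [px|xp|<-]; last by rewrite pP.
  by move=> _; rewrite ltW // La // mem_filter px.
by move=> _; rewrite orbC ltW // bR // mem_filter xp.
Qed.

Lemma finite_cells (P : seq rat) : exists I : seq (interval rat),
  (forall x, x \notin P -> exists2 i, i \in I & x \in i) /\
  {in I, forall i, {in i &, forall x y,
     {in P, forall p, (p < x) = (p < y) /\ (x < p) = (y < p)}%R}}.
Proof.
elim: P => [|p P [I [cI sI]]].
  by exists [:: `]-oo, +oo[%O]; split => // x _; exists `]-oo, +oo[%O.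
(* Each new point [p] splits every earlier cell in two. Some pieces may be empty, which is
   harmless. *)
pose lo i := (Order.meet `]-oo, p[ i)%O; pose hi i := (Order.meet `]p, +oo[ i)%O.
exists ([seq lo i | i <- I] ++ [seq hi i | i <- I]); split.
  move=> x; rewrite inE negb_or => /andP[xp /cI[i iI xi]].
  case: (ltgtP x p) xp => // [xp|px] _.
    exists (lo i); first by rewrite mem_cat map_f.
    by rewrite in_itvI xi in_itv /= xp.
  exists (hi i); first by rewrite mem_cat orbC map_f.
  by rewrite in_itvI xi in_itv /= px.
move=> _ /[!mem_cat]/orP[]/mapP[i iI ->] x y /[!in_itvI]/andP[+ xi]/andP[+ yi];
  rewrite !in_itv /= ?andbT => px py q /[!inE]/predU1P[->|/(sI i iI x y xi yi)//];
  by rewrite px py !ltNge !ltW.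
Qed.

(** * From the order and product topologies to metric boxes *)

Lemma nbhs_rat_ball (x : order_topology rat) (B : set (order_topology rat)) :
  nbhs x B ->
  exists2 e : rat, (0 < e)%R & forall y : rat, (`|y - x| < e)%R -> B y.
Proof.
rewrite itv_nbhsE => -[i [io xi] iB].
suff [e e0 he] : exists2 e : rat, (0 < e)%R &
    forall y : rat, (`|y - x| < e)%R -> y \in i.
  by exists e => // y /he/iB.
case: i io xi {iB} => -[[] a|[]] [[] b|[]] //= _; rewrite in_itv /= ?andbT.
- move=> /andP[ax xb].
  exists (Num.min (x - a) (b - x))%R; first by rewrite lt_min !subr_gt0 ax.
  by move=> y; rewrite lt_min in_itv /= => /andP[]; rewrite !ltr_norml; lra.
- move=> ax; exists (x - a)%R; first by rewrite subr_gt0.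
  by move=> y; rewrite in_itv /= andbT ltr_norml; lra.
- move=> xb; exists (b - x)%R; first by rewrite subr_gt0.
  by move=> y; rewrite in_itv /= ltr_norml; lra.
- by move=> _; exists 1%R.
Qed.

Lemma open_in_power_box n (U : set ('I_n -> rat)) (x : 'I_n -> rat) :
  open_in_power U -> U x ->
  exists2 e : rat, (0 < e)%R &
    forall y : 'I_n -> rat, (forall i, `|y i - x i| < e)%R -> U y.
Proof.
move=> Uo Ux.
pose F : set_system ('I_n -> rat) := filter_from [set e : rat | (0 < e)%R]
  (fun e => [set y | forall i, (`|y i - x i| < e)%R]).
have FF : Filter F.
  apply: filter_from_filter; first by exists 1%R.
  move=> e1 e2 /= e10 e20; exists (Num.min e1 e2); first by rewrite /= lt_min e10.
  by move=> y /= ye; split=> i; have := ye i; rewrite lt_min => /andP[].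
suff Fx : F --> (x : prod_topology (fun _ : 'I_n => order_topology rat)).
  by have [e e0 eU] := Fx U (open_nbhs_nbhs (conj Uo Ux)); exists e.
(* The product topology is the supremum of the topologies induced by the coordinates, so convergence
   of the filter of boxes is checked one coordinate at a time. *)
apply/cvg_sup => i B [_ [[C Co <-] Cx] CB].
have [e e0 eC] := nbhs_rat_ball (open_nbhs_nbhs (conj Co Cx)).
by exists e => // y ye; apply/CB/eC/ye.
Qed.

(** * Finite sets coded by negative points *)

Section CodedSets.
Variable rho : Qneg -> {fset Qpos}.

Lemma A_rel_sign x y : A_rel rho x y -> (x < 0 /\ 0 < y)%R.
Proof. by move=> [u [w [-> -> _]]]; split; [exact: (set_valP u)|exact: (set_valP w)]. Qed.

Hypothesis rho_dense : forall F : {fset Qpos}, dense (rho @^-1` [set F]).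

Lemma A_rel_realize (F : {fset Qpos}) (a b : rat) :
  (a < b)%R -> (b <= 0)%R ->
  exists2 x, (a < x < b)%R &
    forall y, A_rel rho x y <-> exists2 w, w \in F & y = \val w.
Proof.
move=> ab b0.
pose O : set Qneg := [set u | (a < \val u < b)%R].
have Oo : open O.
  exists (`]a, b[ : set (order_topology rat)); first exact: itv_open.
  by apply/seteqP; split => u; rewrite /O /= in_itv.
have m0 : ((a + b) / 2 < 0)%R by lra.
have [u [Ou Fu]] : O `&` rho @^-1` [set F] !=set0.
  apply: rho_dense Oo; exists (exist _ ((a + b) / 2)%R (mem_set m0) : Qneg).
  by rewrite /O /=; apply/andP; split; lra.
exists (\val u) => // y; split.
  by move=> [u' [w [/val_inj <- -> wu]]]; exists w; rewrite // -Fu.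
by move=> [w wF ->]; exists u, w; split; rewrite // Fu.
Qed.

Lemma A_rel_fset (x : rat) : exists F : {fset Qpos},
  forall y, A_rel rho x y <-> exists2 w, w \in F & y = \val w.
Proof.
have [x0|x0] := ltP x 0%R; last first.
  exists fset0 => y; split; last by move=> [].
  by move=> /A_rel_sign[]; rewrite ltNge x0.
pose u : Qneg := exist _ x (mem_set x0).
exists (rho u) => y; split.
  move=> [u' [w [xu -> wu]]]; exists w => //.
  by rewrite (_ : u = u') //; apply: val_inj.
by move=> [w wu ->]; exists u, w.
Qed.

(** Since [g] fixes 0, it maps the finite set coded by [x] (empty if [x] is nonnegative) to a finite
    set of positive rationals, whose fibre under [rho] is dense. *)
Lemma A_rel_transport (g : rat -> rat) (x a b : rat) :
  order_auto g -> g 0%R = 0%R -> (a < b)%R -> (b <= 0)%R ->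
  exists2 z, (a < z < b)%R & forall y, A_rel rho x y <-> A_rel rho z (g y).
Proof.
move=> [gm /bij_inj ginj] g0 ab b0; have [F FE] := A_rel_fset x.
have gpos (w : Qpos) : (0 < g (\val w))%R by rewrite -g0 gm; exact: (set_valP w).
pose gp (w : Qpos) : Qpos := exist _ (g (\val w)) (mem_set (gpos w)).
have [z zi zE] := A_rel_realize [fset gp w | w in F]%fset ab b0.
exists z => // y; rewrite FE zE; split.
  by move=> [w wF ->]; exists (gp w); rewrite // in_imfset.
by move=> [_ /imfsetP[w /= wF ->] /= /ginj yw]; exists w.
Qed.

End CodedSets.

(** * Bounding the variables of a formula *)

Fixpoint term_vars_below (L : language) (N : nat) (t : term L) : Prop :=
  match t with
  | TVar i => i < N
  | TApp f ts => forall k, term_vars_below N (ts k)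
  end.

(** Quantified indices are bounded as well, so that a single [N] serves throughout an induction on
    formulas. *)
Fixpoint vars_below (L : language) (N : nat) (phi : formula L) : Prop :=
  match phi with
  | FEq s t => term_vars_below N s /\ term_vars_below N t
  | FRel r ts => forall k, term_vars_below N (ts k)
  | FNot psi => vars_below N psi
  | FAnd psi chi => vars_below N psi /\ vars_below N chi
  | FEx i psi => i < N /\ vars_below N psi
  end.

Lemma term_vars_below_leq (L : language) (M N : nat) (t : term L) :
  M <= N -> term_vars_below M t -> term_vars_below N t.
Proof.
move=> MN; elim: t => [i|f ts IH] /=; first by move/leq_trans; apply.
by move=> h k; apply: IH.
Qed.

Lemma vars_below_leq (L : language) (M N : nat) (phi : formula L) :
  M <= N -> vars_below M phi -> vars_below N phi.
Proof.
move=> MN; elim: phi => [s t|r ts|psi IH|psi IH chi IH'|i psi IH] /=.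
- by move=> [hs ht]; split; apply: term_vars_below_leq MN _.
- by move=> h k; apply: term_vars_below_leq MN _.
- exact: IH.
- by move=> [/IH ? /IH' ?].
- by move=> [/leq_trans iN /IH ?]; split => //; apply: iN.
Qed.

Lemma finite_max_bound (n : nat) (Q : nat -> 'I_n -> Prop) :
  (forall M N k, M <= N -> Q M k -> Q N k) ->
  (forall k, exists N, Q N k) -> exists N, forall k, Q N k.
Proof.
move=> Qle /choice[f fQ]; exists (\max_k f k) => k.
exact: Qle (leq_bigmax k) (fQ k).
Qed.

Lemma term_vars_bounded (L : language) (t : term L) :
  exists N, term_vars_below N t.
Proof.
elim: t => [i|f ts IH] /=; first by exists i.+1.
apply: finite_max_bound IH => M N k; exact: term_vars_below_leq.
Qed.

Lemma vars_bounded (L : language) (phi : formula L) :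
  exists N, vars_below N phi.
Proof.
elim: phi => [s t|r ts|psi IH|psi [M psiM] chi [N chiN]|i psi [N psiN]] /=.
- have [M sM] := term_vars_bounded s; have [N tN] := term_vars_bounded t.
  exists (maxn M N); split.
    exact: term_vars_below_leq (leq_maxl M N) sM.
  exact: term_vars_below_leq (leq_maxr M N) tN.
- apply: finite_max_bound => [M N k|k]; first exact: term_vars_below_leq.
  exact: term_vars_bounded.
- exact: IH.
- exists (maxn M N); split.
    exact: vars_below_leq (leq_maxl M N) psiM.
  exact: vars_below_leq (leq_maxr M N) chiN.
- exists (maxn i.+1 N); split; first exact: leq_maxl.
  exact: vars_below_leq (leq_maxr i.+1 N) psiN.
Qed.

(** * Back-and-forth along an order automorphism *)

Section BackAndForth.
Variable rho : Qneg -> {fset Qpos}.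
Hypothesis rho_dense : forall F : {fset Qpos}, dense (rho @^-1` [set F]).

(* [b] has the same type as [a] once the nonnegative half-line is moved by [g]:
   for negative points only the coded sets have to correspond. *)
Definition matched (g : rat -> rat) (a b : rat) : Prop :=
  ((0 <= a)%R -> b = g a) /\
  ((a < 0)%R -> (b < 0)%R /\ forall y, A_rel rho a y <-> A_rel rho b (g y)).

Definition sim (N : nat) (g : rat -> rat) (v w : nat -> rat) : Prop :=
  (forall i, i < N -> matched g (v i) (w i)) /\
  (forall i j, i < N -> j < N -> (v i < v j)%R = (w i < w j)%R).

Variables (g h : rat -> rat).
Hypotheses (g_auto : order_auto g) (h_auto : order_auto h).
Hypotheses (gK : cancel g h) (hK : cancel h g).
Hypothesis g0 : g 0%R = 0%R.

Lemma matched_sign a b : matched g a b -> (a < 0)%R = (b < 0)%R.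
Proof.
move=> [ap an]; have [a0|a0] := ltP a 0%R; first by rewrite (an a0).1.
by rewrite ap // -g0 g_auto.1 ltNge a0.
Qed.

Lemma matched_sym a b : matched g a b -> matched h b a.
Proof.
move=> ab; have := matched_sign ab; case: ab => ap an ab0; split.
  by move=> b0; rewrite ap ?gK // leNgt ab0 -leNgt.
rewrite -ab0 => a0; split => // y; have [_ ->] := an a0.
by rewrite hK.
Qed.

Lemma sim_sym N v w : sim N g v w -> sim N h w v.
Proof. by move=> [vw lt]; split=> [i /vw/matched_sym|i j iN jN]; rewrite ?lt. Qed.

(** The forth step. A nonnegative [a] must go to [g a]; a negative [a] equal to some [v j] goes to
    [w j]; any other negative [a] goes to a point with the required coded set, found by density in
    the corresponding cut of the [w j]. *)
Lemma sim_extend N v w i a : sim N g v w -> i < N ->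
  exists b, sim N g [eta v with i |-> a] [eta w with i |-> b].
Proof.
move=> [vw vwlt] iN.
suff [b ab blt] : exists2 b, matched g a b & forall j, j < N -> j != i ->
    (a < v j)%R = (b < w j)%R /\ (v j < a)%R = (w j < b)%R.
  exists b; split => [j jN|j k jN kN] /=; first by case: eqP => // _; apply: vw.
  case: (eqVneq j i) => [_|ji]; case: (eqVneq k i) => [_|ki].
  - by rewrite !ltxx.
  - exact: (blt k kN ki).1.
  - exact: (blt j jN ji).2.
  - exact: vwlt.
have [a0|a0] := leP 0%R a.
  exists (g a); first by split => //; rewrite ltNge a0.
  move=> j jN _; have [wj vj] := vw j jN; have [vj0|vj0] := leP 0%R (v j).
    by rewrite wj // !g_auto.1.
  have wj0 := (vj vj0).1.
  have ga0 : (0 <= g a)%R by rewrite leNgt -g0 g_auto.1 -leNgt.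
  by rewrite (lt_le_trans vj0 a0) (lt_le_trans wj0 ga0) !ltNge !ltW //
    ?(lt_le_trans vj0) ?(lt_le_trans wj0).
have [[j /andP[jN /eqP vja]]|nex] :=
    pselect (exists j, (j < N) && (v j == a)).
  exists (w j); first by rewrite -vja; apply: vw.
  by move=> k kN _; rewrite -vja !vwlt.
(* Putting 0 on the right-hand side of the cut forces [b] to be negative. *)
have [|c [d [cd Lc dR]]] := @finite_cut_itv
    [seq w j | j <- iota 0 N & (v j < a)%R]
    (0%R :: [seq w j | j <- iota 0 N & (a < v j)%R]).
  move=> l r /mapP[j +->]; rewrite mem_filter mem_iota => /andP[vja jN].
  rewrite inE => /predU1P[->|/mapP[k +->]].
    by apply: (((vw j jN).2) _).1; apply: lt_trans a0.
  rewrite mem_filter mem_iota => /andP[avk kN].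
  by rewrite -vwlt //; apply: lt_trans avk.
have d0 : (d <= 0)%R by apply/ltW/dR; rewrite inE eqxx.
have [b /andP[cb bd] bE] := A_rel_transport rho_dense a g_auto g0 cd d0.
exists b.
  split=> [|_]; first by rewrite leNgt a0.
  by split => //; apply: lt_le_trans d0.
move=> j jN _; case: (ltgtP a (v j)) => [avj|vja|avj].
- have bw : (b < w j)%R.
    apply: (lt_trans bd); apply: dR; rewrite inE map_f ?orbT //.
    by rewrite mem_filter avj mem_iota.
  by rewrite bw ltNge ltW.
- have wb : (w j < b)%R.
    apply: lt_trans cb; apply: Lc; rewrite map_f //.
    by rewrite mem_filter vja mem_iota.
  by rewrite wb ltNge ltW.
- by case: nex; exists j; rewrite jN avj eqxx.
Qed.

Lemma sim_eval N v w (s t : term QA_language) : sim N g v w ->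
  term_vars_below N s -> term_vars_below N t ->
  matched g (Defs.eval (QA_structure rho) v s) (Defs.eval (QA_structure rho) w s) /\
  (Defs.eval (QA_structure rho) v s < Defs.eval (QA_structure rho) v t)%R =
  (Defs.eval (QA_structure rho) w s < Defs.eval (QA_structure rho) w t)%R.
Proof.
move=> [vw vwlt].
have m0 : matched g 0%R 0%R by split; rewrite ?g0 ?ltxx.
have pos i : i < N -> (0 < v i)%R = (0 < w i)%R.
  move=> iN; have := matched_sign (vw i iN); have [wi _] := vw i iN.
  have [vi0 _|vi0] := leP 0%R (v i); first by rewrite wi // -[in RHS]g0 g_auto.1.
  by move/esym=> wi0; rewrite !ltNge !ltW.
case: s => [i|f ts]; case: t => [j|f' ts'] //= iN jN; split => //; try exact: vw.
- exact: vwlt.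
- exact: (matched_sign (vw i iN)).
- exact: pos.
Qed.

End BackAndForth.

Lemma sat_sim (rho : Qneg -> {fset Qpos})
    (rho_dense : forall F : {fset Qpos}, dense (rho @^-1` [set F]))
    (g : rat -> rat) (N : nat) (v w : nat -> rat) (phi : formula QA_language) :
  order_auto g -> g 0%R = 0%R -> vars_below N phi -> sim rho N g v w ->
  sat (QA_structure rho) v phi <-> sat (QA_structure rho) w phi.
Proof.
move=> ga g0; have [h gK hK] := ga.2.
have ha := order_auto_inv ga gK hK.
have h0 : h 0%R = 0%R by rewrite -g0 gK.
elim: phi v w => [s t|r ts|psi IH|psi IH chi IH'|i psi IH] v w /=.
- move=> [sN tN] vw.
  have /= [_ st] := sim_eval ga g0 vw sN tN.
  have /= [_ ts] := sim_eval ga g0 vw tN sN.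
  by split=> /eqP e; apply/eqP; move: e; rewrite !eq_le !leNgt st ts.
- case: r ts => ts tsN vw /=.
    by rewrite (sim_eval ga g0 vw (tsN _) (tsN _)).2.
  have [m0 _] := sim_eval ga g0 vw (tsN 0%R) (tsN 0%R).
  have [m1 _] := sim_eval ga g0 vw (tsN 1%R) (tsN 1%R).
  move: m0 m1; set a := Defs.eval _ v (ts 0%R); set a' := Defs.eval _ w (ts 0%R).
  set b := Defs.eval _ v (ts 1%R); set b' := Defs.eval _ w (ts 1%R) => m0 m1.
  (* If [a] is nonnegative or [b] is negative, the relation fails on both sides by signs. Otherwise
     [b' = g b], and the correspondence of coded sets applies. *)
  have [a0|a0] := leP 0%R a.
    split=> /A_rel_sign[+ _]; rewrite -?(matched_sign ga g0 m0) => aneg;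
      by move: a0; rewrite leNgt aneg.
  have [b0|b0] := leP 0%R b; first by rewrite (m1.1 b0); apply: (m0.2 a0).2.
  split=> /A_rel_sign[_ bpos]; first by move: (lt_trans b0 bpos); rewrite ltxx.
  by move: (lt_trans bpos (m1.2 b0).1); rewrite ltxx.
- by move=> psiN /(IH _ _ psiN) <-.
- by move=> [psiN chiN] vw; rewrite (IH _ _ psiN vw) (IH' _ _ chiN vw).
- move=> [iN psiN] vw; split=> -[a].
    have [b vwb] := sim_extend rho_dense ga g0 a vw iN.
    by rewrite (IH _ _ psiN vwb) => ?; exists b.
  (* The back step is the forth step for the inverse [h]. *)
  have wv := sim_sym ga gK hK g0 vw.
  have [b wvb] := sim_extend rho_dense ha h0 a wv iN.
  have vwb := sim_sym ha hK gK h0 wvb.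
  by rewrite -(IH _ _ psiN vwb) => ?; exists b.
Qed.

(** * Finite supports of definable open sets *)

Definition supports (P : seq rat) n (U : set ('I_n -> rat)) : Prop :=
  forall g, order_auto g -> {in P, g =1 id} -> forall x, U x -> U (g \o x).

Lemma extend_comp n (x : 'I_n -> rat) (v : nat -> rat) (f : rat -> rat) k :
  f (v k) = v k -> extend (f \o x) v k = f (extend x v k).
Proof. by rewrite /extend; case: insubP. Qed.

Lemma definable_open_supported (rho : Qneg -> {fset Qpos})
    (rho_dense : forall F : {fset Qpos}, dense (rho @^-1` [set F]))
    n (U : set ('I_n -> rat)) :
  open_in_power U -> definable (QA_structure rho) U ->
  exists P, supports P U.
Proof.
move=> Uo [phi [v UE]]; have [N phiN] := vars_bounded phi.
have [F FE] := choice (A_rel_fset rho).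
pose P := 0%R :: [seq v k | k <- iota 0 N] ++
  flatten [seq [seq \val w | w : Qpos <- F (v k)] | k <- iota 0 N].
have vP k : k < N -> v k \in P.
  by move=> kN; rewrite inE mem_cat map_f ?orbT // mem_iota.
have AP k y : k < N -> A_rel rho (v k) y -> y \in P.
  move=> kN /FE[w wF ->]; rewrite inE mem_cat.
  apply/orP; right; apply/orP; right; apply/flattenP.
  exists [seq \val w | w : Qpos <- F (v k)]; last exact: map_f.
  by apply: map_f; rewrite mem_iota.
exists P => g ga gP x Ux.
have g0 : g 0%R = 0%R by apply: gP; rewrite inE eqxx.
have [h gK hK] := ga.2; have ha := order_auto_inv ga gK hK.
have h0 : h 0%R = 0%R by rewrite -g0 gK.
pose w := extend x v.
have [e e0 eU] := open_in_power_box Uo Ux.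
(* Moving every entry of [w] by less than half of each positive gap preserves strict inequalities.
   The bound [m] lies below these halves and below [e], so the perturbed tuple also stays in [U]. *)
pose gaps := [seq ((w k - w j) / 2)%R | k <- iota 0 N, j <- iota 0 N].
have [|m m0 mR] := @finite_gap 0%R (e :: [seq d <- gaps | (0 < d)%R]).
  by move=> d; rewrite inE mem_filter => /predU1P[->//|/andP[]].
have me : (m < e)%R by apply: mR; rewrite inE eqxx.
have mgap j k : j < N -> k < N -> (w j < w k)%R -> (m < (w k - w j) / 2)%R.
  move=> jN kN jk; apply: mR; rewrite inE mem_filter; apply/orP; right.
  apply/andP; split; first lra.
  by apply: allpairs_f; rewrite mem_iota.
have tauP q : exists t, [/\ (`|t - q| < m)%R, q \in P -> t = q &
    matched rho g t (g q)].
  have [q0|q0] := leP 0%R q.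
    exists q; split; rewrite ?subrr ?normr0 //.
    by split => //; rewrite ltNge q0.
  have gq0 : (g q < 0)%R by rewrite -g0 ga.1.
  case: (boolP (q \in P)) => qP.
    exists q; split; rewrite ?subrr ?normr0 //.
    split; first by rewrite leNgt q0.
    split => // y; rewrite (gP q qP).
    (* The other members of [P] are 0 and positive points, so the negative [q] is a parameter. The
       set it codes lies in [P], hence is fixed pointwise by [g], and [q] can stay in place. *)
    have [k kN qk] : exists2 k, k < N & q = v k.
      move: qP; rewrite inE mem_cat => /predU1P[qE|/orP[]].
      - by move: q0; rewrite qE ltxx.
      - by move=> /mapP[k +->]; rewrite mem_iota; exists k.
      - move=> /flattenP[_ /mapP[k _ ->]] /mapP[u _ qu].
        by move: (lt_trans q0 (set_valP u)); rewrite qu ltxx.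
    rewrite qk; split => Ay; first by rewrite gP // (AP _ _ kN Ay).
    by rewrite -(can_inj gK (gP _ (AP _ _ kN Ay))).
  have qm : (q - m < q)%R by lra.
  (* Transport along [h] pulls the set coded by [g q] back to a point [t] just to the left of
     [q]. *)
  have [t /andP[mt tq] tE] := A_rel_transport rho_dense (g q) ha h0 qm (ltW q0).
  have t0 := lt_trans tq q0.
  exists t; split => //; first by rewrite ltr_norml; apply/andP; split; lra.
  split; first by rewrite leNgt t0.
  by split => // y; rewrite (tE (g y)) gK.
(* As [tau] depends on the point and not on the coordinate, equal entries remain equal. *)
have [tau tauE] := choice tauP.
have Utau : U (tau \o x).
  by apply: eU => i; have [d _ _] := tauE (x i); apply: lt_trans me.
rewrite UE /= in Utau *.
apply: (iffLR (sat_sim rho_dense ga g0 phiN _) Utau).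
have vtau k : k < N -> tau (v k) = v k.
  by move=> kN; have [_ + _] := tauE (v k); apply; apply: vP.
have vg k : k < N -> g (v k) = v k by move=> kN; apply/gP/vP.
have mono j k : j < N -> k < N -> (w j < w k)%R -> (tau (w j) < tau (w k))%R.
  move=> jN kN jk; have := mgap _ _ jN kN jk.
  have [+ _ _] := tauE (w j); have [+ _ _] := tauE (w k).
  by rewrite !ltr_norml; lra.
(* Both [tau] and [g] fix the parameters, so below [N] the two assignments are [tau] and [g] applied
   to the entries of [w]. *)
split=> [k kN|j k jN kN]; rewrite !extend_comp ?vtau ?vg //.
  by have [] := tauE (w k).
rewrite ga.1 -/w; case: (ltgtP (w j) (w k)) => [jk|kj|->]; rewrite ?ltxx //.
- exact: mono.
- by apply/negbTE; rewrite -leNgt ltW // mono.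
Qed.

(** * Invariance in the open core and o-minimality *)

Lemma fixes_inv (P : seq rat) (g h : rat -> rat) :
  cancel g h -> {in P, g =1 id} -> {in P, h =1 id}.
Proof. by move=> gK gP p pP; rewrite -[in LHS](gP p pP) gK. Qed.

(** Each relation symbol is a definable open set and so has a finite support. Supports of the two
    halves of a conjunction are concatenated, and under a quantifier the witness is moved by [g] or
    its inverse. *)
Lemma open_core_supported (rho : Qneg -> {fset Qpos})
    (rho_dense : forall F : {fset Qpos}, dense (rho @^-1` [set F]))
    (N : nat) (phi : formula (open_core_language (QA_structure rho))) :
  vars_below N phi ->
  exists P : seq rat, forall g, order_auto g -> {in P, g =1 id} ->
    forall v w, (forall k, k < N -> w k = g (v k)) ->
    sat (open_core (QA_structure rho)) v phi <->
    sat (open_core (QA_structure rho)) w phi.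
Proof.
have evalE g v w (t : term (open_core_language (QA_structure rho))) :
    (forall k, k < N -> w k = g (v k)) -> term_vars_below N t ->
    Defs.eval (open_core (QA_structure rho)) w t =
    g (Defs.eval (open_core (QA_structure rho)) v t).
  (* There are no function symbols, so every term is a variable. *)
  by move=> vw; case: t => [i iN|[]] /=; apply: vw.
elim: phi => [s t|r ts|psi IH|psi IH chi IH'|i psi IH] /=.
- move=> [sN tN]; exists [::] => g ga _ v w vw.
  rewrite !(evalE _ _ _ _ vw) //; split=> [->//|].
  exact: (bij_inj ga.2).
- move=> tsN; have [P PU] := definable_open_supported rho_dense
    (do_open r) (do_definable r).
  exists P => g ga gP v w vw; have [h gK hK] := ga.2.
  have -> : (fun k => Defs.eval (open_core (QA_structure rho)) w (ts k)) =
      g \o (fun k => Defs.eval (open_core (QA_structure rho)) v (ts k)).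
    by apply/funext => k /=; rewrite (evalE _ _ _ _ vw).
  split; first exact: PU.
  move=> /(PU h (order_auto_inv ga gK hK) (fixes_inv gK gP)).
  by rewrite compA (_ : h \o g = id) //; apply/funext => y /=; rewrite gK.
- move=> /IH[P PE]; exists P => g ga gP v w vw.
  by rewrite (PE g ga gP v w vw).
- move=> [/IH[P PE] /IH'[Q QE]]; exists (P ++ Q) => g ga gPQ v w vw.
  rewrite (PE g ga _ v w vw) ?(QE g ga _ v w vw) // => p pP.
    by apply: gPQ; rewrite mem_cat pP orbT.
  by apply: gPQ; rewrite mem_cat pP.
- move=> [iN /IH[P PE]]; exists P => g ga gP v w vw; have [h gK hK] := ga.2.
  split=> -[a].
    exists (g a); apply/(PE g ga gP [eta v with i |-> a] _ _) => // k kN /=.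
    by case: eqP => // _; apply: vw.
  exists (h a); apply/(PE g ga gP _ [eta w with i |-> a] _) => // k kN /=.
  by case: eqP => // _; apply: vw.
Qed.

Lemma supported_o_minimal (P : seq rat) (X : set rat) :
  (forall g, order_auto g -> {in P, g =1 id} -> forall x, X x -> X (g x)) ->
  exists (points : seq rat) (intervals : seq (interval rat)),
    X = [set` points] `|` \bigcup_(i in [set` intervals]) [set` i].
Proof.
move=> PX; have [I [cI sI]] := finite_cells P.
(* By transitivity on cells, a cell that meets [X] is contained in it. *)
exists [seq p <- P | `[< X p >]], [seq i <- I | `[< [set` i] `<=` X >]].
apply/seteqP; split=> x; last first.
  case=> [|[i]] /=; rewrite mem_filter; first by move=> /andP[/asboolP].
  by move=> /andP[/asboolP iX _] /iX.
move=> Xx; case: (boolP (x \in P)) => xP.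
  by left; rewrite /= mem_filter xP andbT; apply/asboolP.
have [i iI xi] := cI x xP; right; exists i => //=.
rewrite mem_filter iI andbT; apply/asboolP => y yi.
have [g [ga gP <-]] := order_auto_move (sI i iI x y xi yi) xP.
exact: PX.
Qed.

Theorem theorem4p6 (rho : Qneg -> {fset Qpos})
    (rho_dense : forall F : {fset Qpos}, dense (rho @^-1` [set F]))
    (rho_codense : forall F : {fset Qpos}, codense (rho @^-1` [set F])) :
  o_minimal (open_core (QA_structure rho)).
Proof.
move=> X [phi [v XE]]; have [N phiN] := vars_bounded phi.
have [P PE] := open_core_supported rho_dense phiN.
have {}XE y : X y <->
    sat (open_core (QA_structure rho)) (extend (fun _ : 'I_1 => y) v) phi.
  by have /seteqP[XE1 XE2] := XE; split=> [/(XE1 (fun=> y))|/(XE2 (fun=> y))].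
(* Once [g] also fixes the parameters below [N], applying it to the assignment changes only the
   entry [x]. *)
apply: (@supported_o_minimal (P ++ [seq v k | k <- iota 0 N])) => g ga gPv x.
rewrite !XE; apply: (iffLR (PE g ga _ _ _ _)) => [p pP|k kN].
  by apply: gPv; rewrite mem_cat pP.
rewrite -extend_comp //; apply: gPv.
by rewrite mem_cat map_f ?orbT // mem_iota.
Qed.
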